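(* For every integer $n>1$, the path graph $P_n$ on $n$ vertices is a $G_\phi$-graph.
   Context: $\phi$ denotes Euler's totient function, $\phi^0(n)=n$ and $\phi^i(n)=\phi(\phi^{i-1}(n))$. For a set $A$ of positive integers, $A_\phi=\{\phi^k(n): n\in A,\ k\ge 0\}$, and $G_\phi(A)$ is the simple graph with vertex set $A_\phi$ in which distinct vertices $r,s$ are adjacent iff $\phi(r)=s$ or $\phi(s)=r$. A graph $H$ is a $G_\phi$-graph if there exists a set $A$ of positive integers such that $H$ is (isomorphic to) $G_\phi(A)$. *)

(* Defs.v *)
From mathcomp Require Import all_boot.
From mathcomp Require Import classical_sets.

Set Implicit Arguments.
Unset Strict Implicit.
Unset Printing Implicit Defensive.

Local Open Scope classical_set_scope.

(* Simple graphs, with a possibly infinite vertex type. *)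
Record sgraph := SGraph {
  vertex :> Type;
  adj : rel vertex;
  adj_sym : symmetric adj;
  adj_irrefl : irreflexive adj
}.

Definition graph_iso (G H : sgraph) : Prop :=
  exists f : G -> H, bijective f /\ (forall x y : G, adj (f x) (f y) = adj x y).

Definition path_adj (n : nat) : rel 'I_n :=
  fun i j => (i.+1 == j :> nat) || (j.+1 == i :> nat).

Lemma path_adj_sym n : symmetric (@path_adj n).
Proof. by move=> i j; rewrite /path_adj orbC. Qed.

Lemma path_adj_irrefl n : irreflexive (@path_adj n).
Proof. by move=> i; rewrite /path_adj orbb gtn_eqF. Qed.

Definition path_graph (n : nat) : sgraph :=
  SGraph (@path_adj_sym n) (@path_adj_irrefl n).

Definition phi_closure (A : set nat) : set nat :=
  [set m | exists n k : nat, A n /\ m = iter k totient n].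

(* Vertices are elements of the set [phi_closure A] seen as a subtype of [nat].
   The condition [r != s] excludes the loop coming from [totient 1 = 1]. *)
Definition Gphi_adj (A : set nat) : rel (set_type (phi_closure A)) :=
  fun r s => (r != s) && ((totient (val r) == val s) || (totient (val s) == val r)).

Lemma Gphi_adj_sym A : symmetric (@Gphi_adj A).
Proof. by move=> r s; rewrite /Gphi_adj eq_sym orbC. Qed.

Lemma Gphi_adj_irrefl A : irreflexive (@Gphi_adj A).
Proof. by move=> r; rewrite /Gphi_adj eqxx. Qed.

Definition Gphi (A : set nat) : sgraph :=
  SGraph (@Gphi_adj_sym A) (@Gphi_adj_irrefl A).

Definition is_Gphi_graph (H : sgraph) : Prop :=
  exists A : set nat, (forall n : nat, A n -> 0 < n) /\ graph_iso H (Gphi A).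

(* Main.v *)
(** Since totient (2 ^ e) = 2 ^ (e - 1), the iterates of totient on 2 ^ (n - 1)
    form the path 2 ^ (n - 1), ..., 2, 1 with n vertices; so A = {2 ^ (n - 1)}. *)
Require Import Defs.
From mathcomp Require Import all_boot.
From mathcomp Require Import classical_sets.
From mathcomp Require Import zify.

(** On powers of two, [totient] lowers the exponent by one until it stops at 0. By
    [phi_closure_exp2P] the vertices are the [2 ^ i] with [i <= m], so [i |-> 2 ^ i] carries the
    path onto the graph. *)

(* At e = 0 truncation gives 0.-1 = 0, matching totient 1 = 1. *)
Lemma totient_exp2 (e : nat) : totient (2 ^ e) = 2 ^ e.-1.
Proof. by case: e => [|e] //; rewrite totient_pfactor // mul1n. Qed.

Lemma iter_totient_exp2 (k e : nat) : iter k totient (2 ^ e) = 2 ^ (e - k).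
Proof.
by elim: k => [|k IHk]; rewrite ?subn0 // iterS IHk totient_exp2 subnS.
Qed.

Lemma phi_closure_exp2P (m v : nat) :
  phi_closure (set1 (2 ^ m)) v <-> exists2 i, i <= m & v = 2 ^ i.
Proof.
split=> [[_ [k [-> ->]]] | [i le_im ->]].
  by exists (m - k); rewrite ?leq_subr // iter_totient_exp2.
by exists (2 ^ m), (m - i); rewrite iter_totient_exp2 subKn.
Qed.

Lemma exp2_in_phi_closure (m : nat) (i : 'I_m.+1) :
  2 ^ i \in phi_closure (set1 (2 ^ m)).
Proof. by apply/mem_set/phi_closure_exp2P; exists i; rewrite // -ltnS. Qed.

Theorem theorem2p4 (n : nat) (hn : 1 < n) : is_Gphi_graph (path_graph n).
Proof.
case: n hn => // m _.
exists (set1 (2 ^ m)); split=> [_ ->|]; first by rewrite expn_gt0.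
pose f (i : 'I_m.+1) : set_type (phi_closure (set1 (2 ^ m))) :=
  exist _ (2 ^ i) (exp2_in_phi_closure m i).
exists f; split.
  (* The inverse is the 2-adic valuation; on the closure it is at most [m], so [inord] never
     defaults. *)
  exists (fun v => inord (logn 2 (val v))) => [i | v].
    by rewrite /= pfactorK // inord_val.
  apply: val_inj => /=.
  have /set_mem/phi_closure_exp2P[i le_im ->] := valP v.
  by rewrite pfactorK // inordK.
(* On exponents, adjacency reads [i != j] and ([i.-1 = j] or [j.-1 = i]); [i != j] discards the
   fixed point [0.-1 = 0]. *)
move=> i j; rewrite /= /Gphi_adj /path_adj -val_eqE /= !totient_exp2 !eqn_exp2l //.
by lia.
Qed.
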